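(* Let $L>0$, let $c>0$ be a constant, and let $\{\phi_m\}_{m=1}^{M}$ be modulating functions on $[0,L]$ of order at least $2$ with $|\phi_m(x)|\le\nu_1$ and $|\phi_m''(x)|\le\nu_2$ for all $x\in[0,L]$ and all $m=1,\dots,M$. Let $h_1,h_2$ be bounded noise functions on $[0,L]$ with $\|h_1\|_\infty=\delta_1$ and $\|h_2\|_\infty=\delta_2$. Let $\underline{e}=(e_1,\dots,e_M)^{tr}$ be the noise error contribution vector, given by $$e_m=\int_0^L\left[\phi_m(x)h_2(x)-c\,\phi_m''(x)h_1(x)\right]\mathrm{d}x,\qquad m=1,\dots,M.$$ Let $\nu=\max\{\nu_1,\nu_2\}$ and $\delta=\max\{\delta_1,\delta_2\}$. Then $$\|\underline{e}\|_1\le M\,\nu\,\delta\,(1+c)\,L.$$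
   Context: Origin of $\underline e$: for the wave equation $u_{tt}-c\,u_{xx}=f$ on $(0,L)\times(0,T]$ with noisy data $\hat u(x,t^* )=u(x,t^* )+h_1(x)$ and $\hat u_{tt}(x,t^* )=u_{tt}(x,t^* )+h_2(x)$ at a fixed time $t^*$, one has $e_m=\hat K_m-K_m$, where $K_m=\int_0^L\phi_m(x)u_{tt}(x,t^* )\,\mathrm{d}x-c\int_0^L\phi_m''(x)u(x,t^* )\,\mathrm{d}x$ and $\hat K_m$ is the same expression with $\hat u,\hat u_{tt}$ in place of $u,u_{tt}$. The noises $h_1,h_2$ are such that the integrals are defined (measurable). $\|\cdot\|_1$ is the $\ell^1$ norm on $\mathbb{R}^M$ and $\|\cdot\|_\infty$ the sup norm on $[0,L]$. Definition: a function $\phi\neq 0$ on $[0,L]$ is a modulating function of order $l$ ($l\ge1$ an integer) if $\phi\in C^{l}([0,L])$ and $\phi^{(p)}(0)=\phi^{(p)}(L)=0$ for all $p=0,1,\dots,l-1$. *)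

(* Defs.v *)
From HB Require Import structures.
From mathcomp Require Import all_boot all_order all_algebra.
From mathcomp Require Import all_classical all_reals all_analysis.
Set Implicit Arguments.
Unset Strict Implicit.
Unset Printing Implicit Defensive.
Import Order.TTheory GRing.Theory Num.Theory.
Import numFieldNormedType.Exports.
Local Open Scope classical_set_scope.
Local Open Scope ring_scope.

(* Derivatives of a function on a set [A] are taken relative to [A], so they are
   one-sided at the endpoints of a closed interval and depend only on the values
   of [f] on [A]. *)
Definition diff_quot (R : realType) (f : R -> R) (x y : R) : R :=
  (f y - f x) / (y - x).

Definition derivable_in (R : realType) (A : set R) (f : R -> R) (x : R) : Prop :=
  cvg (diff_quot f x y @[y --> within A x^']).

Definition derive_in (R : realType) (A : set R) (f : R -> R) (x : R) : R :=
  lim (diff_quot f x y @[y --> within A x^']).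

Definition derivn_in (R : realType) (A : set R) (n : nat) (f : R -> R) : R -> R :=
  iter n (derive_in A) f.

Definition Cn_in (R : realType) (A : set R) (l : nat) (f : R -> R) : Prop :=
  (forall p x, (p < l)%N -> A x -> derivable_in A (derivn_in A p f) x) /\
  {within A, continuous (derivn_in A l f)}.

Definition modulating (R : realType) (L : R) (l : nat) (phi : R -> R) : Prop :=
  [/\ (1 <= l)%N,
      exists2 x, x \in `[0, L] & phi x != 0,
      Cn_in `[0, L] l phi &
      forall p, (p < l)%N ->
        derivn_in `[0, L] p phi 0 = 0 /\ derivn_in `[0, L] p phi L = 0].

(* Carrier of the Lebesgue (completed Borel) sigma-algebra, on which
   [completed_lebesgue_measure] is defined; [measurable_fun] over the plain
   carrier [R] would mean Borel measurability. *)
Definition lebesgueR (R : realType) : measurableType _ :=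
  caratheodory_type (wlength (@idfun R))^*%mu.

Definition Lebesgue_measurable_fun (R : realType) (A : set R) (f : R -> R) : Prop :=
  measurable_fun (A : set (lebesgueR R)) (f : lebesgueR R -> R).

Definition sup_norm (R : realType) (A : set R) (h : R -> R) : R :=
  sup [set `|h x| | x in A].

Definition l1norm (R : realType) (M : nat) (v : 'cV[R]_M) : R :=
  \sum_(m < M) `|v m ord0|.

Definition noise_error (R : realType) (L c : R) (M : nat)
    (phi : 'I_M -> R -> R) (h1 h2 : R -> R) : 'cV[R]_M :=
  \col_m \int[completed_lebesgue_measure]_(x in `[0, L])
    (phi m x * h2 x - c * derivn_in `[0, L] 2 (phi m) x * h1 x).

(* Main.v *)
Require Import Defs.
From HB Require Import structures.
From mathcomp Require Import all_boot all_order all_algebra.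
From mathcomp Require Import all_classical all_reals all_analysis.
Import Order.TTheory GRing.Theory Num.Theory.
Import numFieldNormedType.Exports.
Local Open Scope classical_set_scope.
Local Open Scope ring_scope.

(* Each integrand is bounded pointwise by [nu * delta * (1 + c)], so each
   component of the error vector is at most [nu * delta * (1 + c) * L]; summing
   over the [M] components gives the estimate. For the integral bound, the
   integral of a nonnegative function is a supremum over the simple functions
   below it, hence monotone; the integrals of the positive and negative parts
   therefore both lie in [[0, C * mu D]], and so does the absolute value of
   their difference. *)

Lemma ge0_le_integral_nomeas (d : measure_display) (T : measurableType d)
    (R : realType) (mu : {measure set T -> \bar R}) (D : set T)
    (f g : T -> \bar R) :
  (forall x, D x -> 0 <= f x)%E -> (forall x, D x -> f x <= g x)%E ->
  (\int[mu]_(x in D) f x <= \int[mu]_(x in D) g x)%E.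
Proof.
move=> f0 fg.
have g0 x : D x -> (0 <= g x)%E by move=> Dx; exact: le_trans (f0 _ Dx) (fg _ Dx).
rewrite ge0_integralE// [leRHS]ge0_integralE//.
(* A simple function below the restriction of [f] to [D] is also below that of [g], so the supremum
   for [g] is over a larger set. *)
apply: ereal_sup_le => _ [h hf <-]; exists h => // x.
by apply: le_trans (hf x) _; exact: lee_restrict.
Qed.

Lemma normr_Rintegral_le_cst (d : measure_display) (T : measurableType d)
    (R : realType) (mu : {measure set T -> \bar R}) (D : set T)
    (f : T -> R) (C : R) :
  measurable D -> (mu D < +oo)%E -> 0 <= C ->
  (forall x, D x -> `|f x| <= C) ->
  `|\int[mu]_(x in D) f x| <= C * fine (mu D).
Proof.
move=> mD muD C0 fC; rewrite /Rintegral integralE.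
set p := (\int[mu]_(x in D) _)%E; set n := (\int[mu]_(x in D) _)%E.
have muDE : (fine (mu D))%:E = mu D by rewrite fineK// ge0_fin_numE.
have p0 : (0 <= p)%E by apply: integral_ge0 => x _; exact: funepos_ge0.
have n0 : (0 <= n)%E by apply: integral_ge0 => x _; exact: funeneg_ge0.
have pC : (p <= (C * fine (mu D))%:E)%E.
  rewrite EFinM muDE -integral_cst//.
  apply: ge0_le_integral_nomeas => x Dx; first exact: funepos_ge0.
  by rewrite funeposE ge_max !lee_fin C0 andbT (le_trans (ler_norm _))// fC.
have nC : (n <= (C * fine (mu D))%:E)%E.
  rewrite EFinM muDE -integral_cst//.
  apply: ge0_le_integral_nomeas => x Dx; first exact: funeneg_ge0.
  rewrite funenegE ge_max !lee_fin C0 andbT (le_trans (ler_norm _))//.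
  by rewrite normrN fC.
(* Both integrals lie between 0 and a real number, so they are finite and their difference can be
   taken in [R]. *)
have pE : p = (fine p)%:E by rewrite fineK// ge0_fin_numE// (le_lt_trans pC) ?ltry.
have nE : n = (fine n)%:E by rewrite fineK// ge0_fin_numE// (le_lt_trans nC) ?ltry.
move: p0 n0 pC nC; rewrite pE nE /= !lee_fin => p0 n0 pC nC.
(* With [K := C * fine (mu D)], the chain is [- K <= - n <= p - n <= p <= K]. *)
rewrite ler_norml; apply/andP; split.
  by rewrite (le_trans (_ : _ <= - fine n)) ?lerN2// lerDr.
by rewrite (le_trans _ pC)// gerBl.
Qed.

(** Both measures are the same outer measure, restricted to different sigma-algebras, so interval
    lengths carry over to the completed one. *)
Lemma completed_lebesgue_measure_set {R : realType} (A : set R) :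
  completed_lebesgue_measure A = lebesgue_measure A.
Proof. by []. Qed.

Lemma measurable_lebesgueR {R : realType} (A : set R) :
  measurable A -> measurable (A : set (lebesgueR R)).
Proof. by move=> mA; exact: sub_caratheodory. Qed.

(** Boundedness makes the supremum genuine: [sup] takes the default value 0 on a set unbounded
    above. *)
Lemma le_sup_norm {R : realType} (A : set R) (h : R -> R) (x : R) :
  [bounded h x | x in A] -> A x -> `|h x| <= sup_norm A h.
Proof.
move=> /pinfty_ex_gt0 [K _ hK] Ax; apply: ub_le_sup; last by exists x.
by exists K => _ [y Ay <-]; exact: hK.
Qed.

Theorem proposition4 (R : realType) (L c : R) (M : nat)
    (phi : 'I_M -> R -> R) (nu1 nu2 : R) (h1 h2 : R -> R) (delta1 delta2 : R) :
  0 < L ->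
  0 < c ->
  (forall m, exists2 l, (2 <= l)%N & modulating L l (phi m)) ->
  (forall m x, x \in `[0, L] -> `|phi m x| <= nu1) ->
  (forall m x, x \in `[0, L] -> `|derivn_in `[0, L] 2 (phi m) x| <= nu2) ->
  Lebesgue_measurable_fun `[0, L] h1 ->
  Lebesgue_measurable_fun `[0, L] h2 ->
  [bounded h1 x | x in `[0, L]%classic] ->
  [bounded h2 x | x in `[0, L]%classic] ->
  sup_norm `[0, L] h1 = delta1 ->
  sup_norm `[0, L] h2 = delta2 ->
  l1norm (noise_error L c phi h1 h2) <=
    M%:R * Num.max nu1 nu2 * Num.max delta1 delta2 * (1 + c) * L.
Proof.
move=> L0 c0 _ phi_le ddphi_le _ _ bh1 bh2 <- <-.
set nu := Num.max _ _; set delta := Num.max _ _.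
have in0L : 0 \in `[0, L] by rewrite in_itv/= lexx ltW.
have h1_le x : x \in `[0, L] -> `|h1 x| <= delta.
  by move=> xL; rewrite le_max le_sup_norm.
have h2_le x : x \in `[0, L] -> `|h2 x| <= delta.
  by move=> xL; rewrite le_max le_sup_norm ?orbT.
have component_le (m : 'I_M) :
    `|noise_error L c phi h1 h2 m ord0| <= nu * delta * (1 + c) * L.
  have phi_nu x : x \in `[0, L] -> `|phi m x| <= nu.
    by move=> xL; rewrite le_max phi_le.
  have ddphi_nu x : x \in `[0, L] -> `|derivn_in `[0, L] 2 (phi m) x| <= nu.
    by move=> xL; rewrite le_max ddphi_le ?orbT.
  (* The signs of [nu] and [delta] are read off from the bounds at the point 0. For [nu] this takes
     an index [m]: if [M = 0], [nu] may be negative, but then both sides of the estimate vanish. *)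
  have nu0 : 0 <= nu := le_trans (normr_ge0 _) (phi_nu _ in0L).
  have delta0 : 0 <= delta := le_trans (normr_ge0 _) (h1_le _ in0L).
  have muL : completed_lebesgue_measure `[0, L]%classic = L%:E.
    by rewrite completed_lebesgue_measure_set lebesgue_measure_itv/= lte_fin L0 sube0.
  rewrite mxE -[X in _ * X]/(fine L%:E) -muL.
  apply: normr_Rintegral_le_cst.
  - by apply: measurable_lebesgueR; exact: measurable_itv.
  - by rewrite /= muL ltry.
  - by rewrite !mulr_ge0// addr_ge0// ltW.
  (* The [h2] term contributes at most [nu * delta], the [h1] term at most [nu * delta * c]. *)
  - move=> x xL; rewrite (le_trans (ler_normB _ _))// mulrDr mulr1 lerD//.
      by rewrite normrM ler_pM// ?phi_nu ?h2_le.
    rewrite !normrM (gtr0_norm c0) -mulrA mulrC (ler_wpM2r (ltW c0))//.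
    by rewrite ler_pM// ?ddphi_nu ?h1_le.
rewrite /l1norm (le_trans (ler_sum _ (fun m _ => component_le m)))//.
by rewrite sumr_const card_ord -[leLHS]mulr_natl !mulrA.
Qed.
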